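(* Let $f,g\in\mathbb{L}$ and let $d,e\in\mathbb{D}$. Then (1) $$N^{d}(fg)=\sum_{c\in\mathbb{D},\,c\le d}\big({}^{c}N^{d}f\big)\,\big({}^{d-c}N^{d}g\big),\qquad {}^{e}N^{d}(fg)=\sum_{c\in\mathbb{D},\,c\le d}\big({}^{c}N^{d}f\big)\,\big({}^{d-(e\oplus c)}N^{d}g\big);$$ (2) $$D^{d}(fg)=R^{d}\sum_{c\in\mathbb{D},\,c\le d}\big({}^{c}D^{d}f\big)\,\big({}^{d-c}D^{d}g\big),\qquad {}^{e}D^{d}(fg)=R^{d}\sum_{c\in\mathbb{D},\,c\le d}\big({}^{c}D^{d}f\big)\,\big({}^{d-(e\oplus c)}D^{d}g\big).$$
   Context: Let $r:\mathbb{R}\to\{-1,1\}$ be the function of period 2 equal to $1$ on $[0,1)$ and $-1$ on $[1,2)$, and let $r_n(t)=r(2^nt)$, $t\in[0,1]$, $n\ge1$, be the Rademacher functions (functions are identified when equal almost everywhere). Let $\mathbb{D}$ be the set of sequences $p=(p_1,p_2,\dots)$ with $p_j\in\{0,1\}$ and $p_j=0$ for all large $j$. For $p\in\mathbb{D}$ put $r^{p}=\prod_j r_j^{p_j}$ (Walsh functions; they are linearly independent). Let $\mathbb{L}$ be the real linear span of $\{r^p:p\in\mathbb{D}\}$; it is an algebra under pointwise multiplication since $r^pr^q=r^{p\oplus q}$, where $\oplus$ denotes term-by-term addition modulo 2. Inequalities $c\le d$ and differences of sequences are term-by-term. For each $j\ge1$ define linear operators on $\mathbb{L}$ by their action on the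 Walsh basis: $N_jr^p=p_j\,r^p$; ${}^1N_j\,r^p=(1-p_j)\,r^p$; $D_jr^p=p_j\,r_jr^p$; ${}^1D_j\,r^p=(1-p_j)\,r_jr^p$; $R_jr^p=r_jr^p$. The left superscript $0$ leaves the operator unchanged: ${}^0N_j=N_j$, ${}^0D_j=D_j$. Operators with distinct indices commute. For $d\in\mathbb{D}$: $N^{d}=\prod_{j:d_j=1}N_j$, $D^{d}=\prod_{j:d_j=1}D_j$, $R^{d}=\prod_{j:d_j=1}R_j$, and for a left superscript sequence $c$, ${}^{c}N^{d}=\prod_{j:d_j=1}{}^{c_j}N_j$ and ${}^{c}D^{d}=\prod_{j:d_j=1}{}^{c_j}D_j$ (empty products are the identity). Only the entries $c_j$ with $d_j=1$ of the left superscript matter, and in all superscripts in the claim these entries lie in $\{0,1\}$. *)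

(* Defs.v *)
From HB Require Import structures.
From mathcomp Require Import all_boot all_order all_algebra finmap.
From mathcomp Require Import all_classical all_reals all_analysis.
Set Implicit Arguments.
Unset Strict Implicit.
Unset Printing Implicit Defensive.
Import Order.TTheory GRing.Theory Num.Theory.
Import numFieldNormedType.Exports.
Local Open Scope classical_set_scope.
Local Open Scope ring_scope.

(* Finitely supported 0-1 sequences. Positions are counted from 0:
   position j stands for the index j + 1, i.e. it goes with r_{j+1}. *)
Notation fbits := {fsfun nat -> bool with false}.

Definition square_wave (R : realType) (t : R) : R := (-1) ^ Num.floor t.

Lemma square_wave_period (R : realType) (t : R) :
  square_wave (t + 2) = square_wave t.
Proof.
by rewrite /square_wave floorDrz ?intr_nat // (intrKfloor 2) exprzDr ?unitrN1 //
  -exprnP sqrrN expr1n mulr1.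
Qed.

Lemma square_wave1 (R : realType) (t : R) :
  0 <= t < 1 -> square_wave t = 1.
Proof. by move=> t01; rewrite /square_wave (@floor_def _ t 0). Qed.

Lemma square_waveN1 (R : realType) (t : R) :
  1 <= t < 2 -> square_wave t = -1.
Proof. by move=> t12; rewrite /square_wave (@floor_def _ t 1). Qed.

Definition rademacher (R : realType) (n : nat) (t : R) : R :=
  square_wave (2 ^+ n * t).

Definition walsh (R : realType) (p : fbits) (t : R) : R :=
  \prod_(j <- finsupp p) rademacher j.+1 t ^+ p j.

(* Functions on [0, 1] are represented by functions on R whose values outside
   [0, 1] are irrelevant; this is equality almost everywhere on [0, 1]. *)
Definition eq01 (R : realType) (f g : R -> R) : Prop :=
  ae_eq (@lebesgue_measure R) [set` `[0, 1]] f g.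

Definition lincomb (R : realType) (a : {fsfun fbits -> R with 0})
    (w : fbits -> R -> R) : R -> R :=
  \sum_(p <- finsupp a) a p *: w p.

Definition LL (R : realType) : set (R -> R) :=
  [set f | exists a : {fsfun fbits -> R with 0}, eq01 f (lincomb a (@walsh R))].

(* The coefficients of f in the Walsh basis; they are unique because the Walsh
   functions are linearly independent. Outside LL the value is meaningless. *)
Definition coords (R : realType) (f : R -> R) : {fsfun fbits -> R with 0} :=
  xget [fsfun] [set a | eq01 f (lincomb a (@walsh R))].

(* The linear operator on LL sending r^p to T p. *)
Definition linext (R : realType) (T : fbits -> R -> R) (f : R -> R) : R -> R :=
  lincomb (coords f) T.

Definition Nop (R : realType) (j : nat) : (R -> R) -> (R -> R) :=
  linext (fun p => (p j)%:R *: @walsh R p).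

Definition N1op (R : realType) (j : nat) : (R -> R) -> (R -> R) :=
  linext (fun p => (1 - (p j)%:R) *: @walsh R p).

Definition Dop (R : realType) (j : nat) : (R -> R) -> (R -> R) :=
  linext (fun p => (p j)%:R *: (@rademacher R j.+1 \* @walsh R p)).

Definition D1op (R : realType) (j : nat) : (R -> R) -> (R -> R) :=
  linext (fun p => (1 - (p j)%:R) *: (@rademacher R j.+1 \* @walsh R p)).

Definition Rop (R : realType) (j : nat) : (R -> R) -> (R -> R) :=
  linext (fun p => @rademacher R j.+1 \* @walsh R p).

(* Left superscripts are integers because term-by-term differences of 0-1
   sequences may be -1; only the values 0 and 1 are meaningful. *)
Definition lN (R : realType) (a : int) (j : nat) : (R -> R) -> (R -> R) :=
  if a == 1 then @N1op R j else @Nop R j.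

Definition lD (R : realType) (a : int) (j : nat) : (R -> R) -> (R -> R) :=
  if a == 1 then @D1op R j else @Dop R j.

Definition opprod (R : realType) (d : fbits)
    (T : nat -> (R -> R) -> (R -> R)) : (R -> R) -> (R -> R) :=
  \big[(fun S S' => S \o S')/idfun]_(j <- finsupp d) T j.

Definition Npow (R : realType) (d : fbits) := opprod d (@Nop R).
Definition Dpow (R : realType) (d : fbits) := opprod d (@Dop R).
Definition Rpow (R : realType) (d : fbits) := opprod d (@Rop R).

Definition lNpow (R : realType) (c : nat -> int) (d : fbits) :=
  opprod d (fun j => @lN R (c j) j).
Definition lDpow (R : realType) (c : nat -> int) (d : fbits) :=
  opprod d (fun j => @lD R (c j) j).

Definition zseq (c : nat -> bool) (j : nat) : int := (c j)%:Z.
Definition subseqz (d c : nat -> bool) (j : nat) : int := (d j)%:Z - (c j)%:Z.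
Definition xorseq (e c : nat -> bool) (j : nat) : bool := e j (+) c j.

Definition below (d : fbits) : set fbits :=
  [set c : fbits | forall j, (c j <= d j)%N].

(* Main.v *)
Require Import Defs.
From HB Require Import structures.
From mathcomp Require Import all_boot all_order all_algebra finmap.
From mathcomp Require Import all_classical all_reals all_analysis.
From mathcomp Require Import zify ring lra.
Import Order.TTheory GRing.Theory Num.Theory.
Import numFieldNormedType.Exports.
Local Open Scope classical_set_scope.
Local Open Scope ring_scope.

(** Every operator in the statement sends a Walsh function r^p to a scalar
multiple of a single Walsh function: N^d multiplies r^p by a product of entries
of p or of their complements, D^d moreover shifts p by d, that is, multiplies
by r^d, and R^d only shifts. Both sides of each identity are bilinear in
(f, g), so it suffices to compare them on f = r^p and g = r^q. There the sum
over c collapses: the factor of the c-th summand that comes from f is the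
product over j in d of [c_j <> p_j], which vanishes unless c is the complement
of p inside d. In that one summand the factor coming from g is the product over
j in d of the bits e_j + p_j + q_j modulo 2, which is also the weight given by
the left-hand side on r^p r^q = r^(p + q). The identities without e are the
case e = 0. The shifts match because (d + p) + (d + q) = p + q, so
that R^d restores the shift by d found on the left.

The reduction to Walsh functions needs the operators to be well defined and
linear on classes of functions equal almost everywhere; this is the linear
independence of the Walsh functions ([walsh_independent]). It is proved without
integration. A combination of Walsh functions is locally constant to the right
of every point, so if it is zero almost everywhere it is zero on all of [0, 1)
([eq01_right_const]). Flipping one binary digit of t changes the sign of one
Rademacher function and preserves the others ([rademacher_flip]); averaging
with a sign over such a flip keeps exactly the terms whose exponent has a
prescribed bit, and after finitely many flips only one term remains.

Linear combinations are handled as lists of pairs (coefficient, exponent), see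
[comb] and [acts]; composition and multiplication then become operations on
lists, with no need to merge repeated exponents. *)

(** * Finitely supported bit sequences *)

(** The shift that an operator with index j applies to exponents is by the unit
vector at j for D and R and by zero for N; the flag b covers both cases. *)
Definition bits_of (b : bool) (s : seq nat) : fbits :=
  [fsfun i in seq_fset tt s => b].

Lemma bits_ofE b s i : bits_of b s i = (i \in s) && b.
Proof. by rewrite fsfunE seq_fsetE; case: (i \in s). Qed.

Definition xorf (p q : fbits) : fbits :=
  [fsfun i in (finsupp p `|` finsupp q)%fset => p i (+) q i].

Lemma xorfE p q i : xorf p q i = p i (+) q i.
Proof.
rewrite fsfunE in_fsetU; case: ifPn => //.
by rewrite negb_or => /andP[/fsfun_dflt-> /fsfun_dflt->].
Qed.

Lemma finite_below (d : fbits) : finite_set (below d).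
Proof.
apply: (@sub_finite_set _ _
  ((fun c : fbits => finsupp c) @^-1` [set` fpowerset (finsupp d)])).
  move=> c cd /=; rewrite fpowersetE; apply/fsubsetP => j.
  rewrite !mem_finsupp => cj; have := cd j.
  by move: cj; case: (c j); case: (d j).
apply: finite_preimage; last exact: finite_fset.
move=> c c' _ _ cc'; apply/fsfunP => j.
have := congr1 (fun A => j \in A) cc'.
by rewrite !mem_finsupp; case: (c j); case: (c' j).
Qed.

(** * Rademacher and Walsh functions, and digit flips *)

Section RademacherWalsh.
Context {R : realType}.
Implicit Types (t : R) (p q : fbits).

Lemma rademacherMM n t : rademacher n t * rademacher n t = 1 :> R.
Proof. by rewrite /rademacher /square_wave -expfzMl mulrNN mulr1 exp1rz. Qed.

Lemma rademacher_neq0 n t : rademacher n t != 0.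
Proof.
by apply/eqP => r0; have := rademacherMM n t; rewrite r0 mul0r => /eqP;
  rewrite eq_sym oner_eq0.
Qed.

(** Exponents outside the support are 0, so products of Walsh functions can be
taken over one common index set. *)
Lemma walsh_widen (A : {fset nat}) p t : (finsupp p `<=` A)%fset ->
  @walsh R p t = \prod_(j <- A) rademacher j.+1 t ^+ p j.
Proof.
move=> pA; apply: big_fset_incl => // j _.
by move=> /fsfun_dflt ->; rewrite expr0.
Qed.

Lemma walsh_xorf p q : @walsh R p \* @walsh R q = @walsh R (xorf p q).
Proof.
apply/funext => t /=.
pose A := (finsupp p `|` finsupp q `|` finsupp (xorf p q))%fset.
rewrite !(walsh_widen A); try by
  apply/fsubsetP => j jA; rewrite !in_fsetU jA ?orbT.
rewrite -big_split /=; apply: eq_bigr => j _; rewrite xorfE.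
by case: (p j); case: (q j); rewrite /= ?expr0 ?expr1 ?mulr1 ?mul1r
  ?rademacherMM.
Qed.

Lemma walsh_neq0 p t : @walsh R p t != 0.
Proof. 
rewrite prodf_seq_neq0; apply/allP => j _ /=.
by rewrite expf_neq0 ?rademacher_neq0.
Qed.

Lemma walsh_bits1 j : @walsh R (bits_of true [:: j]) = rademacher j.+1.
Proof.
apply/funext => t; rewrite (walsh_widen [fset j]%fset).
  by rewrite big_seq_fset1 bits_ofE mem_head.
by apply/fsubsetP => i; rewrite mem_finsupp bits_ofE in_fset1 mem_seq1;
  case: (i == j).
Qed.

Lemma signz_parity (k : int) : exists h : int,
  k = 2 * h /\ (-1) ^ k = 1 :> R \/ k = 2 * h + 1 /\ (-1) ^ k = -1 :> R.
Proof.
have sq (h : int) : (-1) ^ (2 * h) = 1 :> R.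
  by rewrite -exprz_exp -exprnP sqrrN expr1n exp1rz.
have [h [kE|kE]] : exists h : int, k = 2 * h \/ k = 2 * h + 1.
    by exists (k %/ 2)%Z; lia.
  by exists h; left; rewrite kE sq.
by exists h; right; rewrite kE exprzDr ?unitrN1 // sq mul1r expr1z.
Qed.

(** The n-th Rademacher function is 1 where the n-th binary digit of t is 0 and
-1 where it is 1; adding it with weight 2^-n exchanges these digits without
producing a carry. *)
Definition flip_digit n t : R := t + rademacher n t / 2 ^+ n.

(** The floor of 2^m t is determined by the integer part and the first m
digits of t, and there is no carry from the n-th digit. The case m = 0 says
that the flip preserves [0, 1). *)
Lemma floor_flip_low m n t : (m < n)%N ->
  Num.floor (2 ^+ m * flip_digit n t) = Num.floor (2 ^+ m * t).
Proof.
move=> mn; apply: floor_def.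
set N := Num.floor (2 ^+ m * t).
(* With k the floor of 2^n t, the interval [N, N + 1) for 2^m t is the interval
   [2KN, 2KN + 2K) for 2^n t. Both its ends are even, so k + 1 stays inside
   when k is even, and k - 1 when k is odd. *)
have [K K0 K2] : exists2 K : int, 0 < K & 2 ^+ n = 2 ^+ m * (2 * K%:~R) :> R.
  exists (2 ^+ (n - m.+1)); first by rewrite exprn_gt0.
  by rewrite rmorphXn /= -exprS -exprD; congr (_ ^+ _); lia.
have KR : 0 < 2 * K%:~R :> R by rewrite mulr_gt0 ?ltr0z.
have m0 : 0 < 2 ^+ m :> R by rewrite exprn_gt0.
have flipE : 2 ^+ m * flip_digit n t =
    (2 ^+ n * t + rademacher n t) / (2 * K%:~R).
  by rewrite /flip_digit K2; field; rewrite !gt_eqF ?ltr0z.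
rewrite flipE ler_pdivlMr // ltr_pdivrMr //.
rewrite /rademacher /square_wave; set k := Num.floor (2 ^+ n * t).
have /andP[k1 k2] := floor_itv (2 ^+ n * t).
have /andP[N1 N2] := floor_itv (2 ^+ m * t).
rewrite -/k -/N in k1 k2 N1 N2.
have tE : 2 ^+ n * t = 2 * K%:~R * (2 ^+ m * t) by rewrite K2; ring.
have intE (z : int) : (z * (2 * K))%:~R = 2 * K%:~R * z%:~R :> R.
  by rewrite mulrC !rmorphM.
have Nk : N * (2 * K) <= k by rewrite floor_ge_int tE intE ler_pM2l.
have kN : k < (N + 1) * (2 * K).
  by rewrite -(ltr_int R) (le_lt_trans k1) // tE intE ltr_pM2l.
have [h [[kE ->]|[kE ->]]] := signz_parity k.
- have : k + 2 <= (N + 1) * (2 * K) by lia.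
  move: Nk; rewrite -!(ler_int R) !rmorphM !rmorphD /= => ? ?.
  by move: k2; rewrite rmorphD /= => ?; apply/andP; split; lra.
- have : N * (2 * K) + 1 <= k by lia.
  have : k + 1 <= (N + 1) * (2 * K) by lia.
  rewrite -!(ler_int R) !rmorphD !rmorphM !rmorphD /= => ? ?.
  by move: k2; rewrite rmorphD /= => ?; apply/andP; split; lra.
Qed.

Lemma rademacher_flip m n t :
  rademacher m.+1 (flip_digit n.+1 t) =
  (-1) ^+ (m == n) * rademacher m.+1 t :> R.
Proof.
rewrite {1}/rademacher {1}/square_wave.
case: (ltngtP m n) => [mn|nm|->] /=.
- by rewrite mul1r floor_flip_low.
(* Higher digits: 2^m t moves by an even integer. *)
- have [e me] : exists e, m = (n + e.+1)%N by exists (m - n.+1)%N; lia.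
  have [s sE] : exists s : int, rademacher n.+1 t = s%:~R :> R.
    rewrite /rademacher /square_wave.
    have [h [[_ ->]|[_ ->]]] := signz_parity (Num.floor (2 ^+ n.+1 * t)).
      by exists 1.
    by exists (-1); rewrite rmorphN.
  have -> : 2 ^+ m.+1 * flip_digit n.+1 t =
      2 ^+ m.+1 * t + (2 * (2 ^+ e * s))%:~R.
    rewrite /flip_digit sE 2!rmorphM /= rmorphXn /= me -addnS exprD !exprS.
    by field; rewrite gt_eqF // exprn_gt0.
  rewrite floorDrz ?intr_int // intrKfloor exprzDr ?unitrN1 // -exprz_exp.
  by rewrite -exprnP sqrrN expr1n exp1rz mulr1 mul1r.
(* The flipped digit: 2^n t moves by 1 or -1. *)
- rewrite expr1 mulN1r.
  have -> : 2 ^+ n.+1 * flip_digit n.+1 t = 2 ^+ n.+1 * t + rademacher n.+1 t.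
    by rewrite /flip_digit; field; rewrite gt_eqF // exprn_gt0.
  rewrite /rademacher /square_wave; set k := Num.floor (2 ^+ n.+1 * t).
  have [h [[kE sE]|[kE sE]]] := signz_parity k; rewrite sE.
    have -> : 2 ^+ n.+1 * t + 1 = 2 ^+ n.+1 * t + 1%:~R by [].
    rewrite floorDrz ?intr_int // intrKfloor -/k exprzDr ?unitrN1 // sE.
    by rewrite mul1r.
  have -> : 2 ^+ n.+1 * t - 1 = 2 ^+ n.+1 * t + (-1)%:~R by rewrite rmorphN.
  rewrite floorDrz ?intr_int // intrKfloor -/k exprzDr ?unitrN1 // sE.
  by rewrite exprN1 invrN1 mulN1r.
Qed.

Lemma walsh_flip p n t :
  walsh p (flip_digit n.+1 t) = (-1) ^+ p n * walsh p t :> R.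
Proof.
pose A := (n |` finsupp p)%fset.
rewrite !(walsh_widen A); try by
  apply/fsubsetP => j jp; rewrite in_fset1U jp orbT.
under eq_bigr => j _ do rewrite rademacher_flip exprMn -exprM.
rewrite big_split /=; congr (_ * _).
rewrite (big_fsetD1 n) ?in_fset1U ?eqxx //= mul1n big_seq big1 ?mulr1 //.
by move=> j; rewrite in_fsetD1 => /andP[/negbTE-> _]; rewrite expr0.
Qed.

Lemma rademacher_right_const n t :
  \forall u \near t^'+, rademacher n u = rademacher n t.
Proof.
have n0 : 0 < 2 ^+ n :> R by rewrite exprn_gt0.
have /andP[k1 k2] := floor_itv (2 ^+ n * t).
have tk : t < (Num.floor (2 ^+ n * t) + 1)%:~R / 2 ^+ n.
  by rewrite ltr_pdivlMr // mulrC.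
near=> u.
rewrite /rademacher /square_wave; congr (_ ^ _); apply: floor_def.
apply/andP; split.
  apply: (le_trans k1); rewrite ler_pM2l //; near: u; exact: nbhs_right_ge.
by rewrite mulrC -ltr_pdivlMr //; near: u; exact: nbhs_right_lt.
Unshelve. all: by end_near.
Qed.
End RademacherWalsh.

(** * Linear independence almost everywhere *)

Section Independence.
Context {R : realType}.

Lemma near_right_big (I : Type) (s : seq I) (idx : R) (op : R -> R -> R)
    (F : I -> R -> R) (t : R) :
  (forall i, \forall u \near t^'+, F i u = F i t) ->
  \forall u \near t^'+,
    \big[op/idx]_(i <- s) F i u = \big[op/idx]_(i <- s) F i t.
Proof.
move=> Fc; elim: s => [|i s IHs]; first by near=> u; rewrite !big_nil.
near=> u; rewrite !big_cons; congr op; near: u; [exact: Fc|exact: IHs].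
Unshelve. all: by end_near.
Qed.

(** If F t were nonzero, F would be nonzero on a right neighbourhood of t, and
this has positive measure inside [0, 1]. *)
Lemma eq01_right_const (F : R -> R) (t : R) : 0 <= t < 1 -> eq01 F 0 ->
  (\forall u \near t^'+, F u = F t) -> F t = 0.
Proof.
move=> /andP[t0 t1] [A [mA A0 sA]] /nbhs_ballP[e /= e0 eF].
apply: contrapT => Ft0.
pose B := [set` `]t, Num.min (t + e) 1[] : set R.
have tm : t < Num.min (t + e) 1 by rewrite lt_min t1 ltrDl e0.
have BA : B `<=` A.
  move=> u; rewrite /B /= in_itv /= lt_min => /and3P[tu ute u1].
  apply: sA => /= uF; apply: Ft0.
  rewrite -(eF u) //; last by rewrite /ball /= ltr_norml; lra.
  by apply: uF; rewrite in_itv /= ltW ?ltW ?(le_lt_trans t0).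
have : (lebesgue_measure B <= lebesgue_measure A)%E.
  by apply: le_measure => //; rewrite inE //; exact: measurable_itv.
rewrite A0 lebesgue_measure_itv /= lte_fin tm lee_fin; lra.
Qed.

(** Projecting a vanishing combination onto the exponents with p_j = q_j, by
adding to its value at t plus or minus its value at t with digit j flipped,
gives again a vanishing combination. When this has been done for all j in the
supports of the exponents in A, only the term of q is left. *)
Lemma walsh_independent01 (A : seq fbits) (k : fbits -> R) : uniq A ->
  (forall t : R, 0 <= t < 1 -> \sum_(p <- A) k p * walsh p t = 0) ->
  forall q, q \in A -> k q = 0.
Proof.
move=> uA A0 q qA.
have sep (s : seq nat) : forall t : R, 0 <= t < 1 ->
    \sum_(p <- A | all (fun j => (p : fbits) j == q j) s) k p * walsh p t = 0.
  elim: s => [|j s IHs] // t t01.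
  set G := fun u =>
    \sum_(p <- A | all (fun j => (p : fbits) j == q j) s) k p * walsh p u.
  have flip01 : 0 <= flip_digit j.+1 t < 1.
    have := @floor_flip_low _ 0 j.+1 t isT; rewrite !expr0 !mul1r => ft.
    move: t01; rewrite -[0 : R]/(0%:~R) -[1 : R]/((0 + 1)%:~R).
    by rewrite -!floor_eq ft.
  have : G t + (-1) ^+ q j * G (flip_digit j.+1 t) = 0.
    by rewrite /G !IHs // mulr0 addr0.
  rewrite /G mulr_sumr -big_split /=.
  rewrite (eq_bigr (fun p : fbits =>
    if p j == q j then 2 * (k p * walsh p t) else 0)).
    rewrite -big_mkcondr /= -mulr_sumr => /eqP; rewrite mulf_eq0 pnatr_eq0 /=.
    by under eq_bigl do rewrite andbC; move/eqP.
  move=> p _; rewrite walsh_flip.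
  by case: (p j); case: (q j) => /=; rewrite ?expr0 ?expr1; ring.
pose s := flatten [seq finsupp p : seq nat | p <- A].
have := sep s 0; rewrite lexx ltr01 => /(_ isT).
rewrite big_mkcond (bigD1_seq q) //= big_seq_cond big1; last first.
  move=> p /andP[pA pq]; case: ifP => // /allP ps; case/eqP: pq.
  have inS (r : fbits) j : r \in A -> j \notin s -> r j = false.
    move=> rA js; apply: fsfun_dflt; apply: contraNN js => jr.
    by apply/flatten_mapP; exists r.
  apply/fsfunP => j; case: (boolP (j \in s)) => [/ps/eqP //|js].
  by rewrite !inS.
have -> : all (fun j => q j == q j) s by apply/allP => j _; exact: eqxx.
rewrite addr0 => /eqP; rewrite mulf_eq0 (negbTE (walsh_neq0 _ _)) orbF.
by move/eqP.
Qed.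

Lemma walsh_independent (A : seq fbits) (k : fbits -> R) : uniq A ->
  eq01 (\sum_(p <- A) k p *: @walsh R p) 0 -> forall q, q \in A -> k q = 0.
Proof.
move=> uA; set F := \sum_(p <- A) _ => F0.
have FE u : F u = \sum_(p <- A) k p * walsh p u by rewrite /F fct_sumE.
apply: walsh_independent01 => // t t01; rewrite -FE.
apply: eq01_right_const => //.
near=> u; rewrite !FE; near: u.
apply: near_right_big => p; near=> u; congr (_ * _); near: u.
apply: near_right_big => j; near=> u; congr (_ ^+ _); near: u.
exact: rademacher_right_const.
Unshelve. all: by end_near.
Qed.
End Independence.

(** * Operators acting monomially on Walsh functions *)

Section WalshOperators.
Context {R : realType}.
Implicit Types (f g : R -> R) (s : seq (R * fbits)) (p q : fbits).

Definition comb s (w : fbits -> R -> R) : R -> R := \sum_(x <- s) x.1 *: w x.2.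

Lemma eq01_refl f : eq01 f f.
Proof. exact: ae_eq_refl. Qed.

Lemma eq01_sym f g : eq01 f g -> eq01 g f.
Proof. exact: ae_eq_sym. Qed.

Lemma eq01_trans f g h : eq01 f g -> eq01 g h -> eq01 f h.
Proof. exact: ae_eq_trans. Qed.

Lemma eq01_map2 (op : R -> R -> R) f f' g g' : eq01 f f' -> eq01 g g' ->
  eq01 (fun t => op (f t) (g t)) (fun t => op (f' t) (g' t)).
Proof. by apply: filterS2 => t ft gt tI; rewrite ft ?gt. Qed.

Lemma eq01D f f' g g' : eq01 f f' -> eq01 g g' -> eq01 (f + g) (f' + g').
Proof. exact: (eq01_map2 +%R). Qed.

Lemma eq01M f f' g g' : eq01 f f' -> eq01 g g' -> eq01 (f \* g) (f' \* g').
Proof. exact: (eq01_map2 *%R). Qed.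

Lemma eq01_sum (I : Type) (r : seq I) (F G : I -> R -> R) :
  (forall i, eq01 (F i) (G i)) -> eq01 (\sum_(i <- r) F i) (\sum_(i <- r) G i).
Proof.
move=> FG; elim: r => [|i r IHr]; first by rewrite !big_nil; exact: eq01_refl.
by rewrite !big_cons; exact: eq01D.
Qed.

Lemma lincombE (a : {fsfun fbits -> R with 0}) (A : {fset fbits}) w :
  (finsupp a `<=` A)%fset -> lincomb a w = \sum_(p <- A) a p *: w p.
Proof.
move=> aA; apply: big_fset_incl => // p _.
by move=> /fsfun_dflt ->; rewrite scale0r.
Qed.

(** [comb] allows repeated exponents; here equal exponents are merged. *)
Definition coef s : {fsfun fbits -> R with 0} :=
  [fsfun p in seq_fset tt [seq x.2 | x <- s] => \sum_(x <- s | x.2 == p) x.1].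

Lemma lincomb_coef s w : lincomb (coef s) w = comb s w.
Proof.
rewrite (lincombE _ (seq_fset tt [seq x.2 | x <- s])); last first.
  by apply/fsubsetP => p; apply: contraLR => pN;
    rewrite memNfinsupp fsfunE (negbTE pN).
rewrite /comb.
transitivity (\sum_(p <- seq_fset tt [seq x.2 | x <- s])
    \sum_(x <- s | x.2 == p) x.1 *: w x.2).
  apply: eq_big_seq => p ps; rewrite fsfunE ps scaler_suml.
  by apply: eq_bigr => x /eqP->.
move: (seq_fset _ _) (seq_fsetE tt [seq x.2 | x <- s]) => A AE.
under eq_bigr do rewrite big_mkcond.
rewrite exchange_big /=; apply: eq_big_seq => x xs.
rewrite (bigD1_seq x.2) ?fset_uniq ?AE ?map_f //= eqxx.
by rewrite big1 ?addr0 // => p; rewrite eq_sym => /negbTE->.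
Qed.

Lemma LLP f : LL f <-> exists s, eq01 f (comb s (@walsh R)).
Proof.
split=> [[a fa]|[s fs]]; last by exists (coef s); rewrite lincomb_coef.
exists [seq (a p, p) | p <- finsupp a]; rewrite /comb big_map; exact: fa.
Qed.

(** By linear independence, the chosen coefficients are the expected ones, and
they depend only on the class of f. *)
Lemma coords_unique f (a : {fsfun fbits -> R with 0}) :
  eq01 f (lincomb a (@walsh R)) -> coords f = a.
Proof.
move=> fa.
have fc : eq01 f (lincomb (coords f) (@walsh R)).
  apply: (@xgetPex _ [fsfun] [set a | eq01 f (lincomb a (@walsh R))]).
  by exists a.
set c := coords f in fc *.
pose A := (finsupp c `|` finsupp a)%fset.
have ca0 : eq01 (\sum_(p <- A) (c p - a p) *: @walsh R p) 0.
  have cfa := eq01_trans _ _ _ (eq01_sym _ _ fc) fa.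
  have := eq01_map2 (fun x y => x - y) _ _ _ _ cfa
    (eq01_refl (lincomb a (@walsh R))).
  rewrite !(lincombE _ A) ?fsubsetUl ?fsubsetUr // => ca.
  under eq_bigr do rewrite scalerBl; rewrite sumrB.
  by apply: (eq01_trans _ _ _ ca); apply: aeW => t _; rewrite subrr.
apply/fsfunP => p; case: (boolP (p \in A)) => [pA|].
  apply/eqP; rewrite -subr_eq0; apply/eqP.
  exact: (walsh_independent _ _ (fset_uniq A) ca0 p pA).
by rewrite in_fsetU negb_or => /andP[/fsfun_dflt-> /fsfun_dflt->].
Qed.

(** This single condition says that S sends r^p to w p *: r^(sg p), is linear on
LL, preserves LL and respects equality almost everywhere. *)
Definition acts (S : (R -> R) -> (R -> R)) (w : fbits -> R)
    (sg : fbits -> fbits) : Prop :=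
  forall s f, eq01 f (comb s (@walsh R)) ->
    eq01 (S f) (comb [seq (x.1 * w x.2, sg x.2) | x <- s] (@walsh R)).

Lemma acts_linext w sg : acts (linext (fun p => w p *: @walsh R (sg p))) w sg.
Proof.
move=> s f fs; rewrite /linext (@coords_unique f (coef s)) ?lincomb_coef //.
rewrite [X in eq01 X _](_ : _ =
  comb [seq (x.1 * w x.2, sg x.2) | x <- s] (@walsh R)); first exact: eq01_refl.
by rewrite /comb big_map; apply: eq_bigr => x _; rewrite /= scalerA.
Qed.

Lemma acts_comp S S' w w' sg sg' : acts S w sg -> acts S' w' sg' ->
  acts (S' \o S) (fun p => w p * w' (sg p)) (sg' \o sg).
Proof.
move=> Sw Sw' s f /Sw/Sw'; rewrite /comb !big_map.
by under eq_bigr do rewrite /= -mulrA.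
Qed.

Lemma acts_ext S w w' sg sg' : w =1 w' -> sg =1 sg' -> acts S w sg ->
  acts S w' sg'.
Proof. by move=> /funext-> /funext->. Qed.

Lemma acts_id : acts idfun (fun=> 1) id.
Proof.
move=> s f; rewrite (_ : [seq _ | x <- s] = s) //.
by rewrite -[RHS]map_id; apply: eq_map => -[a p] /=; rewrite mulr1.
Qed.

(** The indices in d are distinct, so an operator with index j sees the bit p_j
unchanged by the shifts of the others, and the weights just multiply. *)
Lemma acts_opprod (d : fbits) (b : bool) (T : nat -> (R -> R) -> (R -> R))
    (w : nat -> bool -> R) :
  (forall j, acts (T j) (fun p => w j (p j)) (xorf (bits_of b [:: j]))) ->
  acts (opprod d T) (fun p => \prod_(j <- finsupp d) w j (p j))
    (xorf (bits_of b (finsupp d))).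
Proof.
move=> Tw; rewrite /opprod.
elim: (finsupp d : seq nat) (fset_uniq (finsupp d)) => [_|j s IHs].
  rewrite big_nil; move: acts_id => /acts_ext; apply=> p.
    by rewrite big_nil.
  by apply/fsfunP => i; rewrite xorfE bits_ofE.
rewrite cons_uniq big_cons => /andP[js us].
have := acts_comp _ _ _ _ _ _ (IHs us) (Tw j).
move=> /acts_ext; apply=> p /=.
  by rewrite big_cons mulrC xorfE bits_ofE (negbTE js).
apply/fsfunP => i; rewrite !xorfE !bits_ofE !inE.
have [->|_] := eqVneq i j; first by rewrite (negbTE js).
by [].
Qed.

Lemma comb_mul s t : comb s (@walsh R) \* comb t (@walsh R) =
  comb [seq (x.1 * y.1, xorf x.2 y.2) | x <- s, y <- t] (@walsh R).
Proof.
apply/funext => u; rewrite /comb big_allpairs_dep !fct_sumE /= mulr_suml.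
apply: eq_bigr => x _; rewrite mulr_sumr fct_sumE; apply: eq_bigr => y _.
by rewrite -walsh_xorf; exact: mulrACA.
Qed.

Lemma leibniz_sum (C : set fbits) (A B : fbits -> (R -> R) -> (R -> R))
    (wA wB : fbits -> fbits -> R) sg s t f g : finite_set C ->
  (forall c, acts (A c) (wA c) sg) -> (forall c, acts (B c) (wB c) sg) ->
  eq01 f (comb s (@walsh R)) -> eq01 g (comb t (@walsh R)) ->
  eq01 (\sum_(c \in C) (A c f \* B c g))
    (comb [seq (x.1 * y.1 * \sum_(c \in C) wA c x.2 * wB c y.2,
                xorf (sg x.2) (sg y.2)) | x <- s, y <- t] (@walsh R)).
Proof.
move=> finC aA aB fs gt; rewrite fsbig_finite //.
have AB c := eq01M _ _ _ _ (aA c s f fs) (aB c t g gt).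
apply: (eq01_trans _ _ _ (eq01_sum _ _ _ _ AB)).
under eq_bigr do rewrite comb_mul /comb big_allpairs_dep big_map.
rewrite exchange_big /= /comb big_allpairs_dep.
rewrite [X in eq01 X _](_ : _ = \sum_(x <- s) \sum_(y <- t)
    (x.1 * y.1 * \sum_(c \in C) wA c x.2 * wB c y.2) *:
      walsh (xorf (sg x.2) (sg y.2))); first exact: eq01_refl.
apply: eq_bigr => x _.
under eq_bigr do rewrite big_map.
rewrite exchange_big /=; apply: eq_bigr => y _.
rewrite fsbig_finite // mulr_sumr scaler_suml; apply: eq_bigr => c _ /=.
by congr (_ *: _); ring.
Qed.

(** Bilinear extension: an identity of the Leibniz shape holds on LL as soon as
weights and exponents agree on each pair of Walsh functions. S' is the outer
operator on the right, the identity for N and R^d for D. *)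
Lemma leibniz_acts (C : set fbits) (A B : fbits -> (R -> R) -> (R -> R))
    (wA wB : fbits -> fbits -> R) sg S S' w sg1 sg2 :
  finite_set C ->
  (forall c, acts (A c) (wA c) sg) -> (forall c, acts (B c) (wB c) sg) ->
  acts S w sg1 -> acts S' (fun=> 1) sg2 ->
  (forall p q, \sum_(c \in C) wA c p * wB c q = w (xorf p q)) ->
  (forall p q, sg2 (xorf (sg p) (sg q)) = sg1 (xorf p q)) ->
  forall f g, LL f -> LL g ->
  eq01 (S (f \* g)) (S' (\sum_(c \in C) (A c f \* B c g))).
Proof.
move=> finC aA aB aS aS' wE sgE f g /LLP[s fs] /LLP[t gt].
have fg := eq01M _ _ _ _ fs gt; rewrite comb_mul in fg.
apply: (eq01_trans _ _ _ (aS _ _ fg)); apply: eq01_sym.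
have sumE := leibniz_sum C A B wA wB sg s t f g finC aA aB fs gt.
apply: (eq01_trans _ _ _ (aS' _ _ sumE)).
rewrite !map_allpairs.
rewrite [X in eq01 (comb X _)](_ : _ =
  [seq (x.1 * y.1 * w (xorf x.2 y.2), sg1 (xorf x.2 y.2)) | x <- s, y <- t]);
  first exact: eq01_refl.
congr flatten; apply: eq_map => x; apply: eq_map => y /=.
by rewrite wE sgE mulr1.
Qed.

End WalshOperators.

(** * The Leibniz rules *)

Section Weights.
Context {R : realType}.

(** The eigenvalue of N_j with left superscript a on r^p when p_j = x; the same
factor occurs in D_j. *)
Definition wt (a : int) (x : bool) : R := if a == 1 then 1 - x%:R else x%:R.

Lemma wt_bool (a x : bool) : wt a%:Z x = (a (+) x)%:R.
Proof. by case: a; case: x; rewrite /wt /= ?subrr ?subr0. Qed.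

Lemma acts_lN a j :
  acts (@lN R a j) (fun p => wt a (p j)) (xorf (bits_of false [:: j])).
Proof.
have E p : xorf (bits_of false [:: j]) p = p.
  by apply/fsfunP => i; rewrite xorfE bits_ofE andbF.
rewrite /lN /wt; case: ifP => _.
  apply: acts_ext (acts_linext (fun p => 1 - (p j)%:R) id) => // p;
    exact/esym/E.
apply: acts_ext (acts_linext (fun p => (p j)%:R) id) => // p; exact/esym/E.
Qed.

Lemma rademacher_walsh j p :
  @rademacher R j.+1 \* walsh p = walsh (xorf (bits_of true [:: j]) p).
Proof. by rewrite -walsh_xorf walsh_bits1. Qed.

Lemma acts_lD a j :
  acts (@lD R a j) (fun p => wt a (p j)) (xorf (bits_of true [:: j])).
Proof.
rewrite /lD /wt; case: ifP => _; rewrite /D1op /Dop;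
 under eq_fun do rewrite rademacher_walsh; exact: acts_linext.
Qed.

Lemma acts_Rop j : acts (@Rop R j) (fun p => 1) (xorf (bits_of true [:: j])).
Proof.
rewrite /Rop; under eq_fun do rewrite rademacher_walsh -[walsh _]scale1r.
exact: acts_linext.
Qed.

(** Only c = d minus p contributes: for any other c <= d some j in d has
c_j = p_j, and then the first product is zero. *)
Lemma sum_weights (d e p q : fbits) :
  \sum_(c \in below d) (\prod_(j <- finsupp d) wt (zseq c j) (p j)) *
     (\prod_(j <- finsupp d) wt (subseqz d (xorseq e c) j) (q j)) =
  \prod_(j <- finsupp d) wt (zseq e j) (xorf p q j).
Proof.
pose c0 : fbits := [fsfun j in finsupp d => ~~ p j].
have c0E j : j \in finsupp d -> c0 j = ~~ p j by move=> jd; rewrite fsfunE jd.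
have subE (c : fbits) j : j \in finsupp d ->
    subseqz d (xorseq e c) j = (~~ xorseq e c j)%:Z.
  by rewrite mem_finsupp /subseqz; case: (d j) => // _; case: (xorseq _ _ _).
rewrite (fsbigD1 c0) /=; last 2 first.
- exact: finite_below.
- by move=> j; rewrite fsfunE mem_finsupp; case: (d j); case: (p j).
rewrite fsbig1 ?addr0.
  rewrite -big_split /=; apply: eq_big_seq => j jd.
  rewrite subE // /zseq !wt_bool /xorseq c0E // xorfE.
  by case: (e j); case: (p j); case: (q j); rewrite /= ?mul1r.
move=> c /= [cd cc0]; have [j jd cj] : exists2 j, j \in finsupp d & c j = p j.
  apply: contrapT => H; apply: cc0; apply/fsfunP => j; rewrite fsfunE.
  case: ifPn => jd; last first.
    by move: jd (cd j); rewrite memNfinsupp => /eqP->; case: (c j).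
  case cj: (c j); case pj: (p j) => //.
    by case: H; exists j => //; rewrite cj pj.
  by case: H; exists j => //; rewrite cj pj.
by rewrite (big_fsetD1 j) //= /zseq wt_bool cj addbb !mul0r.
Qed.

Lemma NpowE (d : fbits) : Npow (R := R) d = lNpow (zseq (bits_of false [::])) d.
Proof.
rewrite /Npow /lNpow; congr opprod; apply/funext => j.
by rewrite /zseq bits_ofE.
Qed.

Lemma DpowE (d : fbits) : Dpow (R := R) d = lDpow (zseq (bits_of false [::])) d.
Proof.
rewrite /Dpow /lDpow; congr opprod; apply/funext => j.
by rewrite /zseq bits_ofE.
Qed.

Lemma xorseq0 : xorseq (bits_of false [::]) = id.
Proof. by apply/funext => c; apply/funext => j; rewrite /xorseq bits_ofE. Qed.

Lemma leibniz_lN (f g : R -> R) (d e : fbits) : LL f -> LL g ->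
  eq01 (lNpow (zseq e) d (f \* g))
    (\sum_(c \in below d)
       (lNpow (zseq c) d f \* lNpow (subseqz d (xorseq e c)) d g)).
Proof.
have aN a := acts_opprod d false (fun j => @lN R (a j) j) (fun j => wt (a j))
  (fun j => acts_lN (a j) j).
apply: (leibniz_acts _ _ _ _ _ _ _ idfun _ _ _ (finite_below d)
  (fun c => aN (zseq c)) (fun c => aN (subseqz d (xorseq e c))) (aN (zseq e))
  acts_id (sum_weights d e)) => p q.
by apply/fsfunP => i; rewrite !xorfE bits_ofE andbF.
Qed.

Lemma leibniz_lD (f g : R -> R) (d e : fbits) : LL f -> LL g ->
  eq01 (lDpow (zseq e) d (f \* g))
    (Rpow d (\sum_(c \in below d)
       (lDpow (zseq c) d f \* lDpow (subseqz d (xorseq e c)) d g))).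
Proof.
have aD a := acts_opprod d true (fun j => @lD R (a j) j) (fun j => wt (a j))
  (fun j => acts_lD (a j) j).
have aR := acts_opprod d true (@Rop R) (fun _ _ => 1) acts_Rop.
have {}aR : acts (@Rpow R d) (fun=> 1) (xorf (bits_of true (finsupp d))).
  by apply: (acts_ext _ _ _ _ _ _ _ aR) => // p; rewrite big1.
apply: (leibniz_acts _ _ _ _ _ _ _ (@Rpow R d) _ _ _ (finite_below d)
  (fun c => aD (zseq c)) (fun c => aD (subseqz d (xorseq e c))) (aD (zseq e))
  aR (sum_weights d e)) => p q.
apply/fsfunP => i; rewrite !xorfE.
by case: (bits_of _ _ i); case: (p i); case: (q i).
Qed.

End Weights.

Theorem theorem3p6 (R : realType) (f g : R -> R) (d e : fbits)
    (hf : LL f) (hg : LL g) :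
  [/\ eq01 (Npow d (f \* g))
        (\sum_(c \in below d)
           (lNpow (zseq c) d f \* lNpow (subseqz d c) d g)),
      eq01 (lNpow (zseq e) d (f \* g))
        (\sum_(c \in below d)
           (lNpow (zseq c) d f \* lNpow (subseqz d (xorseq e c)) d g)),
      eq01 (Dpow d (f \* g))
        (Rpow d (\sum_(c \in below d)
           (lDpow (zseq c) d f \* lDpow (subseqz d c) d g))) &
      eq01 (lDpow (zseq e) d (f \* g))
        (Rpow d (\sum_(c \in below d)
           (lDpow (zseq c) d f \* lDpow (subseqz d (xorseq e c)) d g)))].
Proof.
have N0 := leibniz_lN f g d (bits_of false [::]) hf hg.
have D0 := leibniz_lD f g d (bits_of false [::]) hf hg.
rewrite xorseq0 in N0 D0; rewrite NpowE DpowE; split.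
- exact: N0.
- exact: leibniz_lN.
- exact: D0.
- exact: leibniz_lD.
Qed.
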